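(* Let $1<p<\infty$, let $X$ be a separable uniformly convex Banach space with the $\pi_\lambda$-property, let $\mu$ be a measure, and put $Y=L_p(\mu;X)$. Assume that $Y$ is separable and that $1\leq\lambda<\Lambda_Y$. Let $E$ be a Banach space such that $E^*$ is separable. If $Z$ is a closed subspace of $\mathcal{B}(E,Y)$ containing $\mathcal{F}(E,Y)$, then $Z$ has the UBCP. In particular, the same conclusion holds for $Y=L_p([0,1];X)$.
   Context: $L_p(\mu;X)$ is the Bochner space of $p$-integrable $X$-valued functions; it is uniformly convex when $1<p<\infty$ and $X$ is uniformly convex, so $\Lambda_Y$ is defined. $L_p([0,1];X)$ is taken with respect to Lebesgue measure. $\mathcal{B}(E,Y)$ is the Banach space of bounded linear operators $E\to Y$ with the operator norm, and $\mathcal{F}(E,Y)$ is its subspace of bounded finite-rank operators. Uniform ball-covering property (UBCP): a Banach space $Z$ with unit sphere $S_Z$ has the UBCP if there exist $r>0$ and a sequence $(z_j)_{j\ge1}$ in $Z$ such that $S_Z\subseteq\bigcup_{j\ge1}B(z_j,r)$ and $r<\inf_{j\ge1}\|z_j\|$, where $B(z,r)$ is the open ball with center $z$ and radius $r$. By convention, if $Z=\{0\}$ (so $S_Z=\emptyset$) the UBCP assertion is regarded as trivially true. $\pi_\lambda$-property ($\lambda\ge1$): a Banach space $X$ has it if for every finite set $A\subseteq X$ and every $\varepsilon>0$ there is a finite-rank projection (bounded linear idempotent) $P:X\to X$ with $\|P\|\leq\lambda$ and $\|Px-x\|<\varepsilon$ for all $x\in A$. Modulus of convexity of a Banach space $F$: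 $\delta_F(\varepsilon)=\inf\{1-\|\frac{x+y}{2}\| : x,y\in F,\ \|x\|\le1,\ \|y\|\le1,\ \|x-y\|\ge\varepsilon\}$ for $0<\varepsilon\le2$; $F$ is uniformly convex iff $\delta_F(\varepsilon)>0$ for all $0<\varepsilon\le2$. The constant $\Lambda_F$: for uniformly convex $F$, $0<\eta<1$, $\Delta=\delta_F(\eta)$ and $0<t<\Delta/4$, put $\alpha_F(\eta,t)=\min\{\frac{\Delta}{4},\ \frac{\Delta}{2}-t,\ \frac{t(1-\eta)}{2}\}>0$, and define $\Lambda_F=1+\sup\{\alpha_F(\eta,t): 0<\eta<1,\ 0<t<\delta_F(\eta)/4\}$, so that $\Lambda_F>1$. *)

(* Defs.v *)
From HB Require Import structures.
From mathcomp Require Import all_boot all_order all_algebra.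
From mathcomp Require Import generic_quotient ring_quotient.
From mathcomp Require Import all_classical all_reals all_analysis.
From mathcomp Require Import measurable_realfun.

Set Implicit Arguments.
Unset Strict Implicit.
Unset Printing Implicit Defensive.

Import Order.TTheory GRing.Theory Num.Theory.
Import numFieldNormedType.Exports.

Local Open Scope classical_set_scope.
Local Open Scope ring_scope.
Local Open Scope quotient_scope.

Definition separable (T : topologicalType) :=
  exists2 A : set T, countable A & dense A.

Section StronglyMeasurable.
Context d (T : measurableType d) (R : realType) (X : normedModType R).
Implicit Types f g : T -> X.

Definition simple_fun f :=
  finite_set (range f) /\ forall y, measurable (f @^-1` [set y]).

(* Convergence is required everywhere: every almost everywhere limit of simple
   functions is almost everywhere equal to such an f, and Bochner below is a
   quotient by almost everywhere equality. *)
Definition strongly_measurable f :=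
  exists2 s : (T -> X)^nat, forall n, simple_fun (s n) &
    forall t, s n t @[n --> \oo] --> f t.

Lemma simple_fun_preimage f (B : set X) :
  simple_fun f -> measurable (f @^-1` B).
Proof.
move=> [finf mf].
rewrite (_ : _ @^-1` _ = \bigcup_(y in range f `&` B) f @^-1` [set y]).
  by apply: fin_bigcup_measurable => // ; exact: finite_setIl.
apply/seteqP; split => [t Bt|t [y [_ By] /= ->]//].
by exists (f t) => //; split => //; exists t.
Qed.

Lemma simple_fun_op2 (h : X -> X -> X) f g :
  simple_fun f -> simple_fun g -> simple_fun (fun t => h (f t) (g t)).
Proof.
move=> sf sg; split.
  have fin2 := finite_image2 h sf.1 sg.1.
  apply: sub_finite_set fin2 => _ [t _ <-]/=.
  by exists (f t); [exists t|exists (g t) => //; exists t].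
move=> y.
rewrite (_ : _ @^-1` _ = \bigcup_(z in range f)
    (f @^-1` [set z] `&` g @^-1` [set w | h z w = y])).
  apply: fin_bigcup_measurable => [|z _]; first exact: sf.1.
  by apply: measurableI; exact: simple_fun_preimage.
apply/seteqP; split => [t /= ht|t [z _ [/= -> //]]].
by exists (f t); [exists t|].
Qed.

Lemma strongly_measurable_lin (a : R) f g : strongly_measurable f ->
  strongly_measurable g -> strongly_measurable (a *: f + g).
Proof.
move=> [s ss sf] [u su ug].
exists (fun n t => a *: s n t + u n t) => [n|t].
  exact: (@simple_fun_op2 (fun x y => a *: x + y)).
by apply: cvgD; [apply: cvgZl_tmp; exact: sf|exact: ug].
Qed.

Lemma strongly_measurable0 : strongly_measurable (0 : T -> X).
Proof.
exists (fun _ => 0) => [n|t]; last exact: cvg_cst.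
split => [|y].
  by apply: sub_finite_set (finite_set1 (0 : X)) => _ [t _ <-].
have [->|y0] := pselect (y = 0).
  by rewrite (_ : _ @^-1` _ = setT)//; apply/seteqP; split.
rewrite (_ : _ @^-1` _ = set0)//; apply/seteqP; split => // t /= y00.
exact/y0/esym.
Qed.

Lemma strongly_measurable_norm f :
  strongly_measurable f -> measurable_fun setT (fun t => `|f t|).
Proof.
move=> [s ss sf].
apply: (@measurable_fun_cvg _ _ _ _ (fun n t => `|s n t|)) => [n|t _].
  move=> _ B mB; rewrite setTI.
  exact: (@simple_fun_preimage (s n) (Num.norm @^-1` B)).
by apply: cvg_norm; exact: sf.
Qed.

End StronglyMeasurable.

Section BochnerFunctions.
Context d (T : measurableType d) (R : realType).
Variables (mu : {measure set T -> \bar R}) (X : normedModType R).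
Variables (p : R) (p1 : 1 <= p).
Implicit Types f g : T -> X.

Definition Bochner_norm f : \bar R := Lnorm mu p%:E (fun t => (`|f t|)%:E).

Definition Bochner_fun_set : set (T -> X) :=
  [set f | strongly_measurable f /\ (Bochner_norm f < +oo)%E].

Lemma Bochner_norm_ge0 f : (0 <= Bochner_norm f)%E.
Proof. exact: Lnorm_ge0. Qed.

Lemma Bochner_normE f :
  Bochner_norm f = ((\int[mu]_t (`|f t| `^ p)%:E) `^ p^-1)%E.
Proof.
rewrite /Bochner_norm unlock; congr (_ `^ _)%E.
by apply: eq_integral => t _ /=; rewrite normr_id.
Qed.

Let measurable_normX f : strongly_measurable f ->
  measurable_fun setT (fun t => (`|f t| `^ p)%:E).
Proof.
move=> /strongly_measurable_norm mf; apply/measurable_EFinP.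
exact: (measurableT_comp (measurable_powR p)).
Qed.

Let p_gt0 : 0 < p. Proof. exact: lt_le_trans p1. Qed.

Lemma Bochner_normZ a f : strongly_measurable f ->
  Bochner_norm (a *: f) = (`|a|%:E * Bochner_norm f)%E.
Proof.
move=> mf; rewrite !Bochner_normE.
under eq_integral do rewrite /= normrZ powRM// EFinM.
rewrite (ge0_integralZl_EFin mu measurableT _ (measurable_normX mf))//.
rewrite poweRM ?lee_fin ?powR_ge0//; last first.
  by apply: integral_ge0 => t _; rewrite lee_fin powR_ge0.
by rewrite poweR_EFin -powRrM divff ?gt_eqF// powRr1.
Qed.

Lemma Bochner_normD f g : strongly_measurable f -> strongly_measurable g ->
  (Bochner_norm (f + g)%R <= Bochner_norm f + Bochner_norm g)%E.
Proof.
move=> mf mg.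
have nf := strongly_measurable_norm mf.
have ng := strongly_measurable_norm mg.
apply: le_trans (minkowski_EFin mu nf ng p1).
have mfg : strongly_measurable (f + g).
  by rewrite -[f]scale1r; exact: strongly_measurable_lin.
rewrite Bochner_normE unlock.
apply: gt0_ler_poweR.
- by rewrite invr_ge0 ltW.
- by rewrite in_itv/= leey andbT; exact: integral_ge0.
- by rewrite in_itv/= leey andbT; exact: integral_ge0.
apply: ge0_le_integral => //.
- exact: measurable_normX.
- apply/measurable_EFinP => /=; apply: (measurableT_comp (measurable_powR p)).
  by apply: measurableT_comp => //; exact: measurable_funD.
move=> t _ /=; rewrite lee_fin ge0_ler_powR ?nnegrE ?(ltW p_gt0)//.
by rewrite [leRHS]ger0_norm ?addr_ge0// ler_normD.
Qed.

Lemma eq_Bochner_norm f g : strongly_measurable f -> strongly_measurable g ->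
  f = g %[ae mu] -> Bochner_norm f = Bochner_norm g.
Proof.
move=> mf mg fg; rewrite !Bochner_normE; congr (_ `^ _)%E.
apply: ge0_ae_eq_integral => //; [exact: measurable_normX..|].
by apply: filterS fg => t fgt Dt; rewrite fgt.
Qed.

Lemma Bochner_norm_eq0 f : strongly_measurable f -> Bochner_norm f = 0%E ->
  f = 0 %[ae mu].
Proof.
move=> mf /Lnorm_eq0_eq0.
have nf := strongly_measurable_norm mf.
move=> /(_ (proj2 (measurable_EFinP _ _) nf)).
rewrite lte_fin => /(_ p_gt0).
by apply: filterS => t + Dt => /(_ Dt) [/normr0_eq0].
Qed.

Lemma Bochner_fun_lin a f g : Bochner_fun_set f -> Bochner_fun_set g ->
  Bochner_fun_set (a *: f + g).
Proof.
move=> [mf lf] [mg lg]; split; first exact: strongly_measurable_lin.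
have maf : strongly_measurable (a *: f).
  rewrite -[a *: f]addr0; apply: strongly_measurable_lin => //.
  exact: strongly_measurable0.
apply: le_lt_trans (Bochner_normD maf mg) _.
by rewrite lte_add_pinfty// Bochner_normZ// lte_mul_pinfty// lee_fin.
Qed.

Lemma Bochner_fun0 : Bochner_fun_set 0.
Proof.
split; first exact: strongly_measurable0.
rewrite /Bochner_norm (_ : (fun t => _) = cst 0%E).
  by rewrite Lnorm0// gt_eqF// lte_fin.
by apply/funext => t /=; rewrite normr0.
Qed.

End BochnerFunctions.

Section BochnerSpace.
Context d (T : measurableType d) (R : realType).
Variables (mu : {measure set T -> \bar R}) (X : normedModType R).
Variables (p : R) (p1 : 1 <= p).

(* The proof p1 is an argument only so that the vector space structure can be
   inferred from the type. *)
Definition Bochner_pred (_ : 1 <= p) : {pred T -> X} :=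
  mem (Bochner_fun_set mu (X := X) p).

Lemma Bochner_pred_submod : submod_closed (Bochner_pred p1).
Proof.
split => [|a f g]; rewrite !inE; first exact: Bochner_fun0.
exact: Bochner_fun_lin.
Qed.

HB.instance Definition _ :=
  GRing.isSubmodClosed.Build _ _ (Bochner_pred p1) Bochner_pred_submod.

Record Bochner_fun := BochnerFun {
  Bochner_fun_val :> T -> X;
  Bochner_funP : Bochner_fun_val \in Bochner_pred p1 }.

HB.instance Definition _ := [isSub for Bochner_fun_val].
HB.instance Definition _ := [Choice of Bochner_fun by <:].
HB.instance Definition _ := [SubChoice_isSubLmodule of Bochner_fun by <:].

Implicit Types f g : Bochner_fun.

Lemma Bochner_fun_meas f : strongly_measurable f.
Proof. by case: f => f /=; rewrite inE => -[]. Qed.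

Lemma Bochner_fun_fin f : (Bochner_norm mu p f < +oo)%E.
Proof. by case: f => f /=; rewrite inE => -[]. Qed.

Definition ae_null : {pred Bochner_fun} :=
  mem [set f : Bochner_fun | (f : T -> X) = 0 %[ae mu]].

Lemma ae_null_zmod : zmod_closed ae_null.
Proof.
split => [|f g]; rewrite !inE; first by apply: filterS filterT => t _ _.
by move=> /= f0 g0; apply: filterS2 f0 g0 => t f0 g0 Dt /=;
  rewrite !fctE f0// g0// subrr.
Qed.

HB.instance Definition _ := GRing.isZmodClosed.Build _ ae_null ae_null_zmod.

Definition Bochner : Type := Quotient.quot ae_null.

HB.instance Definition _ := GRing.Zmodule.on Bochner.
HB.instance Definition _ := EqQuotient.on Bochner.

Implicit Types u v : Bochner.

Lemma Bochner_eqP f g :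
  reflect ((f : T -> X) = g %[ae mu]) (f == g %[mod Bochner]).
Proof.
rewrite -(Quotient.idealrBE ae_null); apply: (iffP idP); rewrite inE /=.
  by apply: filterS => t + Dt => /(_ Dt) /eqP; rewrite subr_eq0 => /eqP.
by apply: filterS => t + Dt => /(_ Dt) /eqP; rewrite -subr_eq0 => /eqP.
Qed.

Definition Bochner_class f : Bochner := \pi_(Quotient.quot ae_null) f.

Lemma Bochner_classP f g :
  Bochner_class f = Bochner_class g <-> (f : T -> X) = g %[ae mu].
Proof. by split=> [/eqP/Bochner_eqP//|fg]; exact/eqP/Bochner_eqP. Qed.

Lemma Bochner_classK u : Bochner_class (repr u) = u.
Proof. exact: reprK. Qed.

Lemma Bochner_ind (P : Bochner -> Prop) :
  (forall f, P (Bochner_class f)) -> forall u, P u.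
Proof. by move=> Pf u; rewrite -[u]Bochner_classK; exact: Pf. Qed.

Lemma Bochner_classD f g :
  Bochner_class (f + g) = Bochner_class f + Bochner_class g.
Proof. exact: (Quotient.pi_add ae_null). Qed.

Lemma repr_Bochner_class f : (repr (Bochner_class f) : T -> X) = f %[ae mu].
Proof. by apply/Bochner_classP; rewrite Bochner_classK. Qed.

Definition Bochner_scale a u := Bochner_class (a *: repr u).

Lemma Bochner_scale_class a f :
  Bochner_scale a (Bochner_class f) = Bochner_class (a *: f).
Proof.
apply/Bochner_classP; apply: filterS (repr_Bochner_class f) => t ft Dt.
by rewrite -[RHS]/(a *: f t) -(ft Dt).
Qed.

Lemma Bochner_scaleA a b u :
  Bochner_scale a (Bochner_scale b u) = Bochner_scale (a * b) u.
Proof.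
elim/Bochner_ind: u => f.
rewrite (Bochner_scale_class b f) (Bochner_scale_class a) scalerA.
by rewrite -Bochner_scale_class.
Qed.

Lemma Bochner_scale1 : left_id 1 Bochner_scale.
Proof. by elim/Bochner_ind => f; rewrite Bochner_scale_class scale1r. Qed.

Lemma Bochner_scaleDr : right_distributive Bochner_scale +%R.
Proof.
move=> a; elim/Bochner_ind => f; elim/Bochner_ind => g.
rewrite -Bochner_classD (Bochner_scale_class a f) (Bochner_scale_class a g).
by rewrite (Bochner_scale_class a (f + g)) scalerDr Bochner_classD.
Qed.

Lemma Bochner_scaleDl u : {morph Bochner_scale^~ u : a b / a + b}.
Proof.
move=> a b; elim/Bochner_ind: u => f /=.
by rewrite 3!(Bochner_scale_class _ f) scalerDl Bochner_classD.
Qed.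

HB.instance Definition _ := GRing.Zmodule_isLmodule.Build R Bochner
  Bochner_scaleA Bochner_scale1 Bochner_scaleDr Bochner_scaleDl.

Definition Lp_norm u : R := fine (Bochner_norm mu p (repr u)).

Lemma Lp_norm_class f : Lp_norm (Bochner_class f) = fine (Bochner_norm mu p f).
Proof.
congr fine; apply: eq_Bochner_norm; [exact: Bochner_fun_meas..|].
exact: repr_Bochner_class.
Qed.

Lemma Bochner_norm_fin f : Bochner_norm mu p f \is a fin_num.
Proof. by rewrite ge0_fin_numE ?Bochner_fun_fin// Bochner_norm_ge0. Qed.

Lemma Lp_normD u v : Lp_norm (u + v) <= Lp_norm u + Lp_norm v.
Proof.
elim/Bochner_ind: u => f; elim/Bochner_ind: v => g.
rewrite -Bochner_classD !Lp_norm_class.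
rewrite -lee_fin EFinD !fineK ?Bochner_norm_fin//.
by apply: Bochner_normD; [|exact: Bochner_fun_meas..].
Qed.

Lemma Lp_normZ a u : Lp_norm (a *: u) = `|a| * Lp_norm u.
Proof.
elim/Bochner_ind: u => f.
rewrite -[a *: _]/(Bochner_scale a _) Bochner_scale_class !Lp_norm_class.
rewrite Bochner_normZ//; last exact: Bochner_fun_meas.
by rewrite fineM ?Bochner_norm_fin.
Qed.

Lemma Lp_norm_eq0 u : Lp_norm u = 0 -> u = 0.
Proof.
elim/Bochner_ind: u => f; rewrite Lp_norm_class => f0.
have {}f0 : Bochner_norm mu p f = 0%E.
  by rewrite -[LHS]fineK ?Bochner_norm_fin// f0.
have {}f0 := Bochner_norm_eq0 p1 (@Bochner_fun_meas f) f0.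
rewrite (_ : 0 = Bochner_class 0).
  by apply/Bochner_classP.
by apply: (addrI (Bochner_class 0)); rewrite -Bochner_classD !addr0.
Qed.

HB.instance Definition _ := Lmodule_isNormed.Build R Bochner
  Lp_normD Lp_normZ Lp_norm_eq0.

End BochnerSpace.

Section BoundedOperators.
Context (R : realType) (E Y : normedModType R).

Definition bounded_linear : set (E -> Y) :=
  [set f | linear f /\ exists M : R, forall x, `|f x| <= M * `|x|].

Definition bounded_linear_pred : {pred E -> Y} := mem bounded_linear.

Lemma bounded_linear_submod : submod_closed bounded_linear_pred.
Proof.
split => [|a f g]; rewrite !inE.
  split; first by move=> k x y; rewrite -[RHS]/(k *: (0 : Y) + 0) scaler0 addr0.
  by exists 0 => x; rewrite normr0 mul0r.
move=> [lf [M fM]] [lg [N gN]]; split.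
  move=> k x y; rewrite !fctE lf lg !scalerDr !scalerA (mulrC k).
  by rewrite addrACA.
exists (`|a| * M + N) => x; rewrite !fctE (le_trans (ler_normD _ _))//.
by rewrite mulrDl lerD// normrZ -mulrA ler_wpM2l.
Qed.

HB.instance Definition _ := GRing.isSubmodClosed.Build _ _
  bounded_linear_pred bounded_linear_submod.

Record bounded_op := BoundedOp {
  bounded_op_val :> E -> Y;
  bounded_opP : bounded_op_val \in bounded_linear_pred }.

HB.instance Definition _ := [isSub for bounded_op_val].
HB.instance Definition _ := [Choice of bounded_op by <:].
HB.instance Definition _ := [SubChoice_isSubLmodule of bounded_op by <:].

Implicit Types f g : bounded_op.

Lemma bounded_op_linear f : linear f.
Proof. by case: f => f /= /[!inE] -[]. Qed.

HB.instance Definition _ f :=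
  GRing.isLinear.Build R E Y *:%R (bounded_op_val f) (bounded_op_linear f).

Definition op_norm f : R := sup [set `|f x| | x in [set x | `|x| <= 1]].

Lemma op_norm_has_sup f :
  has_sup [set `|f x| | x in [set x : E | `|x| <= 1]].
Proof.
split; first by exists `|f 0|; exists 0 => //=; rewrite normr0.
have [_ [M fM]] : bounded_linear f by apply: set_mem; exact: bounded_opP.
exists `|M| => _ [x /= x1 <-]; rewrite (le_trans (fM x))//.
rewrite (le_trans (ler_norm _))// normrM normr_id.
by rewrite -[leRHS]mulr1 ler_wpM2l.
Qed.

Lemma op_norm_ub f x : `|x| <= 1 -> `|f x| <= op_norm f.
Proof.
move=> x1; apply: ub_le_sup; first by case: (op_norm_has_sup f).
by exists x.
Qed.

Lemma op_norm_le f (M : R) :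
  (forall x, `|x| <= 1 -> `|f x| <= M) -> op_norm f <= M.
Proof.
move=> fM; apply: ge_sup; first by case: (op_norm_has_sup f).
by move=> _ [x /= x1 <-]; exact: fM.
Qed.

Lemma op_norm_bound f x : `|f x| <= op_norm f * `|x|.
Proof.
have [->|x0] := eqVneq x 0; first by rewrite linear0 !normr0 mulr0.
rewrite -ler_pdivrMr ?normr_gt0// mulrC.
have /op_norm_ub : `|(`|x|^-1 *: x)| <= 1.
  by rewrite normrZ normfV normr_id mulVf// normr_eq0.
by move=> /(_ f); rewrite linearZ/= normrZ normfV normr_id.
Qed.

Lemma op_normD f g : op_norm (f + g) <= op_norm f + op_norm g.
Proof.
apply: op_norm_le => x x1; rewrite (le_trans (ler_normD _ _))//.
by rewrite lerD// op_norm_ub.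
Qed.

Lemma op_normZ_le a f : op_norm (a *: f) <= `|a| * op_norm f.
Proof.
apply: op_norm_le => x x1.
by rewrite -[_ x]/(a *: f x) normrZ ler_wpM2l// op_norm_ub.
Qed.

Lemma op_norm_ge0 f : 0 <= op_norm f.
Proof.
by rewrite (le_trans (normr_ge0 (f 0)))// op_norm_ub// normr0.
Qed.

Lemma op_normZ a f : op_norm (a *: f) = `|a| * op_norm f.
Proof.
apply/eqP; rewrite eq_le op_normZ_le/=.
have [->|a0] := eqVneq a 0; first by rewrite normr0 mul0r op_norm_ge0.
rewrite -ler_pdivlMl ?normr_gt0// -normfV -[in leLHS](scalerK a0 f).
exact: op_normZ_le.
Qed.

Lemma op_norm_eq0 f : op_norm f = 0 -> f = 0.
Proof.
move=> f0; apply/val_inj/funext => x /=; apply/normr0_eq0/le_anti.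
by rewrite normr_ge0 andbT (le_trans (op_norm_bound f x))// f0 mul0r.
Qed.

HB.instance Definition _ := Lmodule_isNormed.Build R bounded_op
  op_normD op_normZ op_norm_eq0.

Definition finite_rank (f : E -> Y) :=
  exists n (v : 'I_n -> Y), forall x, exists c : 'I_n -> R,
    f x = \sum_(i < n) c i *: v i.

End BoundedOperators.

Section BanachSpaceProperties.
Context (R : realType).
Implicit Types V F : normedModType R.

Definition closed_subspace V (Z : set V) :=
  [/\ Z 0, forall (a : R) x y, Z x -> Z y -> Z (a *: x + y) & closed Z].

(* The uniform ball-covering property of a subspace Z of V, with the norm
   inherited from V. *)
Definition UBCP V (Z : set V) :=
  Z = [set 0] \/
  exists r (z : V ^nat), [/\ 0 < r, forall j, Z (z j),
    Z `&` [set x | `|x| = 1] `<=` \bigcup_j ball (z j) r &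
    r < inf (range (fun j => `|z j|))].

Definition pi_property V (lambda : R) :=
  forall (A : set V) (e : R), finite_set A -> 0 < e ->
    exists P : bounded_op V V, [/\ forall x, P (P x) = P x, finite_rank P,
      `|P| <= lambda & forall x, A x -> `|P x - x| < e].

Local Open Scope ereal_scope.

(* The infimum is taken in \bar R, so that the modulus of the zero space is
   +oo, the infimum of the empty set. *)
Definition convexity_modulus F (e : R) : \bar R :=
  ereal_inf [set r | exists x y : F, [/\ (`|x| <= 1)%R, (`|y| <= 1)%R,
    (e <= `|x - y|)%R & r = (1 - `|2^-1 *: (x + y)|)%:E]].

Definition uniformly_convex F :=
  forall e : R, (0 < e <= 2)%R -> 0 < convexity_modulus F e.

(* Lambda is only meaningful for uniformly convex F; there all the values of
   alpha in the supremum are positive. *)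
Definition alpha F (eta t : R) : \bar R :=
  let Delta := convexity_modulus F eta in
  mine (Delta * 4^-1%:E)
       (mine (Delta * 2^-1%:E - t%:E) (t * (1 - eta) / 2)%:E).

Definition Lambda F : \bar R :=
  1 + ereal_sup [set a | exists eta t, [/\ (0 < eta < 1)%R, (0 < t)%R,
    t%:E < convexity_modulus F eta * 4^-1%:E & a = alpha F eta t]].

End BanachSpaceProperties.

(* The Lebesgue measure of [0, 1] seen as a measure on the real line that is
   null outside [0, 1]. *)
Definition lebesgue01 (R : realType) :
  {measure set (measurableTypeR R) -> \bar R} :=
  mrestr (@lebesgue_measure R) (measurable_itv `[0 : R, 1 : R]).

(* Main.v *)
Require Import Defs.
From HB Require Import structures.
From mathcomp Require Import all_boot all_order all_algebra.
From mathcomp Require Import all_classical all_reals all_analysis.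
From mathcomp Require Import measurable_realfun ring lra.

(** An operator T of norm 1 is close to a multiple of a rank-one operator of
    comparable norm.  Take x in the unit ball with |T x| almost 1, let
    u = T x / |T x|, let phi be a norm-one functional with phi u = 1
    ([norming_functional], the Hahn-Banach theorem), and let P = phi (_) u, a
    projection of norm 1 that fixes T x.  Convexity of Y makes t I - P a strict
    contraction for a small t > 0: if y in the unit ball is far from P y, then
    (y + P y) / 2 is short, hence so is its image P y, and the summand t y
    cannot make up for it; if y is close to P y, then t y - P y is close to
    (t - 1) P y ([norming_projection_gap]).  Therefore T is within
    (1 - kappa) / t of the rank-one operator P T / t, with kappa depending on Y
    only, whereas the norm of P T / t is |P T| / t, which is as close to 1 / t
    as desired ([rank_one_cover]).

    The centres can be taken in a countable set because psi (_) u depends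
    continuously on (psi, u), where psi ranges over the separable space E^* and
    u over the separable space Y.  Rank-one operators belong to Z, so those
    among the countably many whose norm exceeds the radius by a fixed margin
    give the UBCP ([UBCP_rank_one]).  The convexity used is that midpoints of points of the
    unit ball at distance at least eta stay at a distance D > 0 from the sphere,
    for a single eta < 1; a Lambda_Y above lambda >= 1 provides such an eta
    ([midpoint_gap_Lambda]).

    For Lebesgue measure on [0, 1], it remains to see that L_p is separable
    ([separable_Bochner]).  Finite sums of functions equal to a vector of a
    countable dense set on a ray with rational endpoint are dense: the sets
    whose indicators times vectors they approximate form a lambda-system, which
    contains all Borel sets by the pi-lambda theorem, and simple functions are
    dense by dominated convergence. *)

Import Order.TTheory GRing.Theory Num.Theory.
Import numFieldNormedType.Exports.

Local Open Scope classical_set_scope.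
Local Open Scope ring_scope.

Set Implicit Arguments.
Unset Strict Implicit.
Unset Printing Implicit Defensive.

(** * The Hahn-Banach theorem through minimal sublinear functionals *)

Section Sublinear.
Context {R : realType} {V : lmodType R}.
Implicit Types (q s : V -> R) (x y u : V).

Definition sublinear q :=
  (forall x y, q (x + y) <= q x + q y) /\
  (forall (a : R) x, 0 <= a -> q (a *: x) = a * q x).

(** Homogeneity follows from one inequality, by applying it to the inverse
    factor. *)
Lemma sublinear_le q : q 0 = 0 -> (forall x y, q (x + y) <= q x + q y) ->
  (forall (a : R) x, 0 < a -> q (a *: x) <= a * q x) -> sublinear q.
Proof.
move=> q0 qD qZ; split=> // a x; rewrite le_eqVlt => /predU1P[<-|a0].
  by rewrite scale0r mul0r.
apply/le_anti; rewrite qZ//=.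
have := qZ a^-1 (a *: x); rewrite invr_gt0 => /(_ a0).
by rewrite scalerK ?gt_eqF// ler_pdivlMl.
Qed.

Lemma sublinear0 q : sublinear q -> q 0 = 0.
Proof. by move=> [_ qZ]; have := qZ 0 0 (lexx 0); rewrite scale0r mul0r. Qed.

Lemma sublinear_oppr_le q x : sublinear q -> - q (- x) <= q x.
Proof.
by move=> sq; have := sq.1 x (- x); rewrite subrr (sublinear0 sq); lra.
Qed.

(** The largest sublinear functional below q whose value at - u is at most
    - q u.  Tilting serves twice: applied to the norm it forces a minimal
    functional below it to norm u, and applied to a minimal functional it proves
    that this functional is odd. *)
Definition tilt q u y : R :=
  inf [set q (y + t *: u) - t * q u | t in [set t | 0 <= t]].

Lemma tilt_has_inf q u y : sublinear q ->
  has_inf [set q (y + t *: u) - t * q u | t in [set t | 0 <= t]].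
Proof.
move=> [qD qZ]; split.
  by exists (q (y + 0 *: u) - 0 * q u); exists 0 => /=.
exists (- q (- y)) => _ [t /= t0 <-].
have := qD (y + t *: u) (- y); rewrite addrAC subrr add0r qZ//; lra.
Qed.

Lemma tilt_le q u y t : sublinear q -> 0 <= t ->
  tilt q u y <= q (y + t *: u) - t * q u.
Proof.
by move=> sq t0; apply: ge_inf; [case: (tilt_has_inf u y sq)|exists t].
Qed.

Lemma le_tilt q u y (m : R) : sublinear q ->
  (forall t, 0 <= t -> m <= q (y + t *: u) - t * q u) -> m <= tilt q u y.
Proof.
move=> sq mle; apply: lb_le_inf; first by case: (tilt_has_inf u y sq).
by move=> _ [t /= t0 <-]; exact: mle.
Qed.

Lemma tilt_sublinear q u : sublinear q -> sublinear (tilt q u).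
Proof.
move=> sq; have [qD qZ] := sq; apply: sublinear_le => [|x y|a x a0].
- apply/le_anti/andP; split.
    have := tilt_le u 0 sq (lexx 0).
    by rewrite scale0r mul0r subr0 addr0 (sublinear0 sq).
  by apply: le_tilt => // t t0; rewrite add0r qZ// subrr.
- rewrite -lerBlDl; apply: le_tilt => // t t0; rewrite lerBlDr -lerBlDl.
  apply: le_tilt => // s s0.
  have := tilt_le u (x + y) sq (addr_ge0 s0 t0).
  have := qD (x + s *: u) (y + t *: u); rewrite addrACA -scalerDl; lra.
- rewrite -ler_pdivrMl//; apply: le_tilt => // t t0; rewrite ler_pdivrMl//.
  apply: le_trans (tilt_le u (a *: x) sq (mulr_ge0 (ltW a0) t0)) _.
  by rewrite -scalerA -scalerDr qZ ?(ltW a0)// -mulrA -mulrBr.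
Qed.

Lemma tilt_le_self q u y : sublinear q -> tilt q u y <= q y.
Proof.
move=> sq; have := tilt_le u y sq (lexx 0).
by rewrite scale0r mul0r subr0 addr0.
Qed.

Lemma tiltN q u : sublinear q -> tilt q u (- u) <= - q u.
Proof.
move=> sq; have := tilt_le u (- u) sq ler01.
by rewrite scale1r mul1r addNr (sublinear0 sq) sub0r.
Qed.

(** The pointwise infimum of a chain of sublinear functionals is sublinear,
    since two members of a chain have a common lower bound in it; it is finite
    because each of them is bounded below by y |-> - N (- y). *)
Lemma minimal_sublinear N : sublinear N ->
  exists q, [/\ sublinear q, forall y, q y <= N y &
    forall s, sublinear s -> (forall y, s y <= q y) -> s = q].
Proof.
move=> sN; pose T := {q | sublinear q /\ forall y, q y <= N y}.
pose below (q s : T) := `[< forall y, sval s y <= sval q y >].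
have [| | |A Atot|q qmin] := @Zorn T below.
- by move=> q; exact/asboolP.
- move=> q r s /asboolP qr /asboolP rs; apply/asboolP => y.
  exact: le_trans (qr y).
- move=> [q hq] [s hs] /asboolP/= qs /asboolP/= sq; apply/eq_exist/funext => y.
  by apply/le_anti; rewrite qs sq.
- have [A0|/set0P[q0 Aq0]] := eqVneq A set0.
    by exists (exist _ N (conj sN (fun=> lexx _))) => s; rewrite A0.
  pose m y := inf [set sval (q : T) y | q in A].
  have infA y : has_inf [set sval (q : T) y | q in A].
    split; first by exists (sval q0 y), q0.
    exists (- N (- y)) => _ [[q /= [sq qN]] _ <-].
    by apply: le_trans (sublinear_oppr_le y sq); rewrite lerN2.
  have m_le (q : T) y : A q -> m y <= sval q y.
    by move=> Aq; apply: ge_inf; [case: (infA y)|exists q].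
  have le_m y (b : R) : (forall q : T, A q -> b <= sval q y) -> b <= m y.
    move=> bA; apply: lb_le_inf; first by case: (infA y).
    by move=> _ [q Aq <-]; exact: bA.
  have sm : sublinear m.
    apply: sublinear_le => [|x y|a x a0].
    + apply/le_anti/andP; split.
        by rewrite -(sublinear0 (svalP q0).1); exact: m_le.
      by apply: (le_m) => q _; rewrite (sublinear0 (svalP q).1).
    + rewrite -lerBlDl; apply: (le_m) => q Aq; rewrite lerBlDr -lerBlDl.
      apply: (le_m) => r Ar.
      have [s [As sr sq]] : exists s : T,
          [/\ A s, sval s x <= sval r x & sval s y <= sval q y].
        have [/asboolP rq|/asboolP qr] := Atot _ _ Aq Ar; last by exists q.
        by exists r.
      have := m_le s (x + y) As; have := (svalP s).1.1 x y; lra.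
    + rewrite -ler_pdivrMl//; apply: (le_m) => q Aq; rewrite ler_pdivrMl//.
      by rewrite -((svalP q).1.2 _ _ (ltW a0)); exact: m_le.
  have mN y : m y <= N y by exact: le_trans (m_le _ _ Aq0) ((svalP q0).2 y).
  exists (exist _ m (conj sm mN)) => s As; apply/asboolP => y; exact: m_le.
- exists (sval q); split; [exact: (svalP q).1|exact: (svalP q).2|].
  move=> s ss sq.
  have sN' y : s y <= N y by exact: le_trans (sq y) ((svalP q).2 y).
  by rewrite -(qmin (exist _ s (conj ss sN')))//; exact/asboolP.
Qed.

(** By minimality q coincides with each of its tilts, so that q (- u) <= - q u,
    and an odd sublinear functional is linear. *)
Lemma minimal_sublinear_scalar q : sublinear q ->
  (forall s, sublinear s -> (forall y, s y <= q y) -> s = q) -> scalar q.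
Proof.
move=> sq qmin; have [qD qZ] := sq.
have qN x : q (- x) = - q x.
  apply/le_anti; apply/andP; split; last first.
    by have := sublinear_oppr_le (- x) sq; rewrite opprK.
  rewrite -[in leLHS](qmin (tilt q x)); first exact: tiltN.
    exact: tilt_sublinear.
  by move=> y; exact: tilt_le_self.
have qDE x y : q (x + y) = q x + q y.
  apply/le_anti; rewrite qD/=.
  have := qD (- x) (- y); rewrite -opprD !qN; lra.
move=> a x y; rewrite qDE; congr (_ + _).
have [a0|/ltW a0] := leP 0 a; first exact: qZ.
by rewrite -[in LHS](opprK a) scaleNr qN qZ ?oppr_ge0// mulNr opprK.
Qed.

End Sublinear.

Lemma norming_functional {R : realType} {V : normedModType R} (u : V) :
  exists phi : bounded_op V R, phi u = `|u| /\ forall y, `|phi y| <= `|y|.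
Proof.
have sN : sublinear (Num.norm : V -> R).
  by split=> [x y|a x a0]; rewrite ?ler_normD// normrZ ger0_norm.
have [q [sq qN qmin]] := minimal_sublinear (tilt_sublinear u sN).
have lq := minimal_sublinear_scalar sq qmin.
have q_le y : q y <= `|y| by apply: le_trans (qN y) (tilt_le_self _ _ sN).
have qopp y : q (- y) = - q y.
  by have := lq (-1) y 0; rewrite addr0 (sublinear0 sq) addr0 scaleN1r mulN1r.
have q_norm y : `|q y| <= `|y|.
  by rewrite ler_norml q_le -(normrN y) lerNl -qopp q_le.
have qP : q \in bounded_linear_pred (E := V) (Y := R).
  by rewrite inE; split=> //; exists 1 => x; rewrite mul1r.
exists (BoundedOp qP); split=> //=.
apply/le_anti; rewrite q_le/= -lerN2 -qopp.
exact: le_trans (qN _) (tiltN u sN).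
Qed.

(** * Covering the unit sphere by balls centred at rank-one operators *)

Section Prelim.
Context {R : realType}.

Lemma dense_dist (V : normedModType R) (A : set V) (x : V) (e : R) :
  dense A -> 0 < e -> exists2 a, A a & `|x - a| < e.
Proof.
move=> dA e0; have [a [xa Aa]] : ball x e `&` A !=set0.
  apply: dA; last exact: ball_open.
  by exists x; exact: ballxx.
by exists a => //; move: xa; rewrite -ball_normE.
Qed.

Lemma countable_nonempty_range (T : Type) (A : set T) :
  countable A -> A !=set0 -> exists f : nat -> T, range f = A.
Proof.
move=> /pfcard_geP[->/set0P|[f] _]; first by rewrite eqxx.
by exists f; apply/seteqP; split=> [_ [n _ <-]|x Ax]; [exact: funS|exact: surj].
Qed.

End Prelim.

Section RankOne.
Context {R : realType} {E Y : normedModType R}.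

Lemma rank_one_bounded (psi : bounded_op E R) (u : Y) :
  (fun x => psi x *: u) \in bounded_linear_pred (E := E) (Y := Y).
Proof.
rewrite inE; split=> [a x y|]; first by rewrite linearP scalerDl scalerA.
exists (op_norm psi * `|u|) => x.
by rewrite normrZ mulrAC ler_wpM2r// op_norm_bound.
Qed.

Definition rank_one psi u : bounded_op E Y :=
  BoundedOp (rank_one_bounded psi u).

Lemma finite_rank_rank_one psi u : finite_rank (rank_one psi u).
Proof.
exists 1%N, (fun=> u) => x; exists (fun=> psi x).
by rewrite big_ord1.
Qed.

(** This modulus of continuity of (psi, u) |-> rank_one psi u is what makes the
    set of rank-one operators separable. *)
Lemma rank_one_dist psi psi' u u' :
  `|rank_one psi u - rank_one psi' u'| <=
  `|psi - psi'| * `|u| + `|psi'| * `|u - u'|.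
Proof.
apply: op_norm_le => x x1.
rewrite -[_ x]/(psi x *: u - psi' x *: u').
rewrite -(subrKA (psi' x *: u)) -scalerBl -scalerBr.
rewrite (le_trans (ler_normD _ _))// !normrZ lerD// ler_wpM2r//.
  exact: (op_norm_ub (psi - psi')).
exact: op_norm_ub.
Qed.

Lemma rank_one_approx (A : set (bounded_op E R)) (B : set Y) psi u (e : R) :
  dense A -> dense B -> 0 < e ->
  exists psi' u', [/\ A psi', B u' & `|rank_one psi u - rank_one psi' u'| < e].
Proof.
move=> dA dB e0.
have pos (a : R) : 0 <= a -> 0 < e / 2 / (a + 1).
  by move=> a0; rewrite !divr_gt0//; lra.
have small (a b : R) : 0 <= a -> b < e / 2 / (a + 1) -> 0 <= b ->
    b * a < e / 2.
  move=> a0; rewrite ltr_pdivlMr; last by lra.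
  move=> bae b0; apply: le_lt_trans bae; rewrite ler_wpM2l//; lra.
have [psi' Apsi' psi'e] := dense_dist psi dA (pos _ (normr_ge0 u)).
have [u' Bu' u'e] := dense_dist u dB (pos _ (normr_ge0 psi')).
exists psi', u'; split=> //; apply: le_lt_trans (rank_one_dist _ _ _ _) _.
have := small _ _ (normr_ge0 u) psi'e (normr_ge0 _).
have := small _ _ (normr_ge0 psi') u'e (normr_ge0 _).
rewrite (mulrC `|u - u'|); lra.
Qed.

End RankOne.

Section Covering.
Context {R : realType}.

(** For D > 0, this says that the modulus of convexity of Y at eta is at least
    D, without a value of the modulus when no pair of points is eta apart. *)
Definition midpoint_gap (Y : normedModType R) (eta D : R) :=
  forall x y : Y, `|x| <= 1 -> `|y| <= 1 -> eta <= `|x - y| ->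
    `|2^-1 *: (x + y)| <= 1 - D.

(** The supremum in Lambda exceeds lambda - 1 >= 0, so it is not over the empty
    set: there are eta and t > 0 with 4 t below the modulus of convexity at
    eta. *)
Lemma midpoint_gap_Lambda (Y : normedModType R) (lambda : R) : 1 <= lambda ->
  (lambda%:E < Lambda Y)%E ->
  exists eta D, [/\ 0 < eta < 1, 0 < D <= 1 & midpoint_gap Y eta D].
Proof.
move=> l1; rewrite /Lambda; set S := [set a | _].
have [->|/set0P[_ [eta [t [eta01 t0 tmod _]]]] _] := eqVneq S set0.
  by rewrite ereal_sup0 addeNy ltNge leNye.
(* The modulus is +oo if no two points of the unit ball are eta apart, hence
   the cap by 1. *)
exists eta, (Num.min 1 t); split=> //.
  by rewrite lt_min ltr01 t0/= ge_min lexx.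
move=> x y x1 y1 xy.
have : (convexity_modulus Y eta <= (1 - `|2^-1 *: (x + y)|)%:E)%E.
  by apply: ereal_inf_lbound; exists x, y.
have quarter_ge0 : (0 <= (4^-1)%:E :> \bar R)%E by rewrite lee_fin invr_ge0.
move=> /(lee_wpmul2r quarter_ge0)/(lt_le_trans tmod).
rewrite -EFinM lte_fin => ?.
have : Num.min 1 t <= t by rewrite ge_min lexx orbT.
lra.
Qed.

(** With P y = phi y *: u, either y is far from P y, and then
    |P y| = |P ((y + P y) / 2)| <= 1 - D because P has norm 1 and fixes P y; or
    t y - P y = t (y - P y) - (1 - t) P y has norm at most t eta + (1 - t).  The
    value t = D / 2 balances the two bounds up to a constant factor. *)
Lemma norming_projection_gap (Y : normedModType R) (eta D : R) (u y : Y)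
    (phi : bounded_op Y R) :
  0 < eta < 1 -> 0 < D <= 1 -> midpoint_gap Y eta D ->
  `|u| = 1 -> phi u = 1 -> (forall y, `|phi y| <= `|y|) -> `|y| <= 1 ->
  `|(D / 2) *: y - phi y *: u| <= 1 - D * (1 - eta) / 2.
Proof.
move=> /andP[eta0 eta1] /andP[D0 D1] gapY u1 phiu phi_le y1.
have t0 : 0 < D / 2 by lra.
have Py1 : `|phi y *: u| <= 1.
  by rewrite normrZ u1 mulr1 (le_trans (phi_le y)).
have [far|near] := leP eta `|y - phi y *: u|.
  have small : `|phi y| <= 1 - D.
    have := le_trans (phi_le _) (gapY _ _ y1 Py1 far).
    rewrite linearZ linearD linearZ/= phiu.
    rewrite -[_ *: _]/(2^-1 * (phi y + phi y * 1)).
    by rewrite (_ : 2^-1 * _ = phi y); last by field.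
  have tri : `|(D / 2) *: y - phi y *: u| <= D / 2 * `|y| + `|phi y|.
    apply: le_trans (ler_normB _ _) _.
    by rewrite (normrZ (D / 2)) (normrZ (phi y)) u1 mulr1 (gtr0_norm t0).
  have : D / 2 * `|y| <= D / 2 by rewrite ler_piMr//; lra.
  have : 0 <= D * eta by apply: mulr_ge0; lra.
  lra.
have -> : (D / 2) *: y - phi y *: u =
    (D / 2) *: (y - phi y *: u) - (1 - D / 2) *: (phi y *: u).
  by rewrite scalerBr scalerBl scale1r opprB addrA subrK.
apply: le_trans (ler_normB _ _) _.
rewrite (normrZ (D / 2)) (normrZ (1 - D / 2)).
rewrite !gtr0_norm; [|lra..].
have : D / 2 * `|y - phi y *: u| <= D / 2 * eta by rewrite ler_wpM2l//; lra.
have : (1 - D / 2) * `|phi y *: u| <= 1 - D / 2 by rewrite ler_piMr//; lra.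
lra.
Qed.

(** The approximating operator is P T / t, where t = D / 2 and P is the
    projection onto the line of T x along the kernel of a functional norming
    T x, for some x in the unit ball with |T x| > 1 - e; then
    |P T| >= |P (T x)| = |T x|. *)
Lemma rank_one_cover (E Y : normedModType R) (eta D e : R)
    (T : bounded_op E Y) :
  0 < eta < 1 -> 0 < D <= 1 -> midpoint_gap Y eta D -> 0 < e <= 1 -> `|T| = 1 ->
  exists psi u, `|T - rank_one psi u| <= 2 / D * (1 - D * (1 - eta) / 2) /\
    2 / D * (1 - e) < `|rank_one (E := E) (Y := Y) psi u|.
Proof.
move=> eta01 D01 gapY /andP[e0 e1] T1; have /andP[D0 D1] := D01.
have c0 : 0 < 2 / D by rewrite divr_gt0.
have [_ [x /= x1 <-]] := sup_adherent e0 (op_norm_has_sup T).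
rewrite -[sup _]/(`|T|) T1 => Tx.
have Tx0 : `|T x| != 0 by rewrite gt_eqF//; lra.
have [phi [phiTx phi_le]] := norming_functional (T x).
pose u := `|T x|^-1 *: T x.
have u1 : `|u| = 1 by rewrite normrZ normfV normr_id mulVf.
have phiu : phi u = 1 by rewrite linearZ/= phiTx -[_ *: _]/(_ * _) mulVf.
have psiP : (fun y => phi (T y)) \in bounded_linear_pred (E := E) (Y := R).
  rewrite inE; split=> [a y z|]; first by rewrite !linearP.
  exists 1 => y; apply: le_trans (phi_le _) _.
  by rewrite -T1; exact: op_norm_bound.
exists (BoundedOp psiP), ((2 / D) *: u); split.
  apply: op_norm_le => y y1.
  rewrite -[_ y]/(T y - phi (T y) *: ((2 / D) *: u)).
  have Ty1 : `|T y| <= 1 by rewrite -T1; exact: op_norm_ub.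
  have := norming_projection_gap eta01 D01 gapY u1 phiu phi_le Ty1.
  have -> : T y - phi (T y) *: ((2 / D) *: u) =
      (2 / D) *: ((D / 2) *: T y - phi (T y) *: u).
    rewrite scalerBr !scalerA (mulrC (phi _)).
    by rewrite (_ : 2 / D * (D / 2) = 1) ?scale1r//; field; rewrite gt_eqF.
  by rewrite normrZ gtr0_norm// ler_pM2l.
apply: lt_le_trans (op_norm_ub _ x1).
rewrite -[_ x]/(phi (T x) *: ((2 / D) *: u)) phiTx.
rewrite (normrZ `|T x|) (normrZ (2 / D)) u1 mulr1 normr_id (gtr0_norm c0).
by rewrite mulrC ltr_pM2r.
Qed.

(** With c = 2 / D and k the contraction gap of [norming_projection_gap], T is
    within c (1 - k) of some rank-one operator of norm almost c.  Replacing that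
    operator by one from a countable family costs less than c k / 8, which
    leaves room for the radius c (1 - k / 2) strictly below the lower bound
    c (1 - k / 4) imposed on the norms of the centres. *)
Lemma UBCP_rank_one (E Y : normedModType R) (eta D : R)
    (Z : set (bounded_op E Y)) :
  0 < eta < 1 -> 0 < D <= 1 -> midpoint_gap Y eta D ->
  separable (bounded_op E R) -> separable Y -> closed_subspace Z ->
  (forall f : bounded_op E Y, finite_rank f -> Z f) -> UBCP Z.
Proof.
move=> eta01 D01 gapY [A cA dA] [B cB dB] [Z0 Zlin _] Zfin.
have /andP[D0 D1] := D01; have /andP[eta0 eta1] := eta01.
have [Z1|] := pselect (Z = [set 0]); [by left|move=> Zn0; right].
pose c := 2 / D; pose k := D * (1 - eta) / 2.
have c0 : 0 < c by rewrite divr_gt0.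
have k0 : 0 < k by rewrite divr_gt0// mulr_gt0//; lra.
have k1 : k <= 2^-1.
  have : D * (1 - eta) <= 1 by rewrite mulr_ile1//; lra.
  by rewrite /k; lra.
have ck0 : 0 < c * k by exact: mulr_gt0.
pose C := [set z | exists psi u, [/\ A psi, B u, z = rank_one psi u &
  c * (1 - k / 4) <= `|z|]].
have cover (T : bounded_op E Y) : `|T| = 1 ->
    exists2 z, C z & `|T - z| < c * (1 - k / 2).
  move=> T1.
  have e01 : 0 < k / 8 <= 1 by apply/andP; split; lra.
  have [psi [u []]] := rank_one_cover eta01 D01 gapY e01 T1.
  rewrite -/c -/k => Tnear big.
  have ck8 : 0 < c * k / 8 by lra.
  have [psi' [u' [Apsi' Bu' near]]] := rank_one_approx psi u dA dB ck8.
  exists (rank_one psi' u').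
    exists psi', u'; split=> //.
    have := lerB_dist (rank_one psi u) (rank_one psi u - rank_one psi' u').
    rewrite subKr; lra.
  have := ler_distD (rank_one psi u) T (rank_one psi' u'); lra.
have [T ZT T1] : exists2 T, Z T & `|T| = 1.
  have [T [ZT T0]] : exists T, Z T /\ T <> 0.
    apply: contrapT => noT; apply: Zn0; apply/seteqP; split=> [T ZT|_ ->//].
    by apply: contrapT => T0; apply: noT; exists T.
  exists (`|T|^-1 *: T); first by rewrite -[_ *: _]addr0; exact: Zlin.
  by rewrite normrZ normfV normr_id mulVf// normr_eq0; exact/eqP.
have [z0 Cz0 _] := cover T T1.
have cC : countable C.
  apply: (@sub_countable _ _ _ [set rank_one x.1 x.2 | x in A `*` B]).
    apply: subset_card_le => _ [psi [u [Apsi Bu -> _]]].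
    by exists (psi, u).
  apply: (card_le_trans (card_image_le _ _)).
  exact: countableX.
have [z zC] := countable_nonempty_range cC (ex_intro _ z0 Cz0).
have Cz j : C (z j) by rewrite -zC; exists j.
exists (c * (1 - k / 2)), z; split.
- by rewrite mulr_gt0//; lra.
- move=> j; have [psi [u [_ _ -> _]]] := Cz j.
  exact/Zfin/finite_rank_rank_one.
- move=> S [_ /= S1]; have [y Cy Sy] := cover S S1.
  move: Cy; rewrite -zC => -[j _ zj]; exists j => //.
  by rewrite -ball_normE /= distrC zj.
- apply: (@lt_le_trans _ _ (c * (1 - k / 4))); first by rewrite ltr_pM2l//; lra.
  apply: lb_le_inf; first by exists `|z 0%N|, 0%N.
  by move=> _ [j _ <-]; have [psi [u [_ _ _]]] := Cz j.
Qed.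

End Covering.

(** * Density of simple functions in Bochner spaces *)

Section BochnerDensity.
Context d (T : measurableType d) (R : realType).
Variables (mu : {measure set T -> \bar R}) (X : normedModType R).
Variables (p : R) (p1 : 1 <= p).
Implicit Types (f g : T -> X) (A B : set T) (x y : X).

Local Notation N f := (Bochner_norm mu p f).

Let p_gt0 : 0 < p. Proof. exact: lt_le_trans p1. Qed.

Lemma strongly_measurableD f g : strongly_measurable f ->
  strongly_measurable g -> strongly_measurable (f + g).
Proof. by rewrite -[f in _ (f + g)]scale1r; exact: strongly_measurable_lin. Qed.

Lemma strongly_measurableB f g : strongly_measurable f ->
  strongly_measurable g -> strongly_measurable (f - g).
Proof.
by move=> mf mg; rewrite addrC -scaleN1r; exact: strongly_measurable_lin.
Qed.

Lemma simple_fun_strongly_measurable f : simple_fun f -> strongly_measurable f.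
Proof. by move=> sf; exists (fun=> f) => // t; exact: cvg_cst. Qed.

Lemma Bochner_norm_lt f (e : R) : 0 < e ->
  (\int[mu]_t (`|f t| `^ p)%:E < (e `^ p)%:E)%E -> (N f < e%:E)%E.
Proof.
move=> e0; rewrite Bochner_normE.
have : (0 <= \int[mu]_t (`|f t| `^ p)%:E)%E.
  by apply: integral_ge0 => t _; rewrite lee_fin powR_ge0.
case: (\int[mu]_t _)%E => [r| |]; [|by move=> _; rewrite ltNge leey|by []].
rewrite poweR_EFin lee_fin !lte_fin => r0 rep.
rewrite -[e](powRr1 (ltW e0)) -(mulfV (lt0r_neq0 p_gt0)) powRrM.
by apply: gt0_ltr_powR => //; rewrite ?invr_gt0// nnegrE ?powR_ge0.
Qed.

Definition step A x (t : T) : X := \1_A t *: x.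

Lemma stepE A x t : step A x t = if t \in A then x else 0.
Proof.
by rewrite /step indicE; case: (t \in A); rewrite ?scale1r ?scale0r.
Qed.

Lemma step_simple A x : measurable A -> simple_fun (step A x).
Proof.
move=> mA; split.
  apply: (@sub_finite_set _ _ [set x; 0]); last exact: finite_set2.
  by move=> _ [t _ <-]; rewrite stepE; case: ifP => _; [left|right].
move=> y.
rewrite (_ : _ @^-1` _ = A `&` [set t | x = y] `|` ~` A `&` [set t | 0 = y]).
  have cstm (P : Prop) : measurable [set t : T | P].
    have [HP|HP] := pselect P.
      by rewrite (_ : [set _ | _] = setT)//; apply/seteqP; split.
    by rewrite (_ : [set _ | _] = set0)//; apply/seteqP; split.
  by apply: measurableU; apply: measurableI => //; exact: measurableC.
apply/seteqP; split=> t /=; rewrite stepE.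
  by case: ifPn => [/set_mem At ->|/negP At ->]; [left|right];
    split=> //; move/mem_set.
move=> [[At <-]|[At <-]]; first by rewrite mem_set.
by case: ifPn => // /set_mem.
Qed.

Lemma step_strongly_measurable A x :
  measurable A -> strongly_measurable (step A x).
Proof. by move=> mA; exact/simple_fun_strongly_measurable/step_simple. Qed.

(** The norm of step A x is |x| (mu A)^(1/p); bounding mu A by a power e^p
    avoids extended-real roots. *)
Lemma Bochner_norm_step A x (e : R) : measurable A -> 0 < e ->
  (mu A < (e `^ p)%:E)%E -> (N (step A x) <= (`|x| * e)%:E)%E.
Proof.
move=> mA e0 Ae.
have [->|x0] := eqVneq x 0.
  rewrite normr0 mul0r Bochner_normE integral0_eq ?poweR0r//.
  - by rewrite invr_eq0 lt0r_neq0.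
  - by move=> t _; rewrite /step scaler0 normr0 powR0// lt0r_neq0.
have nx0 : 0 < `|x| by rewrite normr_gt0.
apply/ltW/Bochner_norm_lt; first exact: mulr_gt0.
rewrite (eq_integral (fun t => (`|x| `^ p * \1_A t)%:E)); last first.
  move=> t _; rewrite stepE indicE; case: (t \in A); first by rewrite mulr1.
  by rewrite normr0 mulr0 powR0// lt0r_neq0.
under eq_integral do rewrite EFinM.
rewrite ge0_integralZl_EFin ?powR_ge0//; last first.
  exact/measurable_EFinP/measurable_indic.
rewrite integral_indic// setIT powRM ?(ltW e0)// EFinM.
by rewrite lte_pmul2l ?lte_fin ?powR_gt0// fin_numE.
Qed.


Lemma powR_cvg0_seq (a : R^nat) : (forall n, 0 <= a n) ->
  a n @[n --> \oo] --> 0 -> a n `^ p @[n --> \oo] --> 0.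
Proof.
move=> a0 cvga; apply/cvgrPdist_lt => e e0.
have e'0 : 0 < e `^ p^-1 by rewrite powR_gt0.
have /cvgrPdist_lt /(_ _ e'0) := cvga.
apply: filterS => n; rewrite !sub0r !normrN !ger0_norm ?powR_ge0// => ae.
rewrite -[ltRHS](powRr1 (ltW e0)) -(mulVf (lt0r_neq0 p_gt0)) powRrM.
by apply: gt0_ltr_powR => //; rewrite nnegrE ?powR_ge0.
Qed.

(** Let the simple functions s n converge to f pointwise, and replace s n t by 0
    wherever |s n t| > 2 |f t|.  This does not affect the limit, because
    |s n t| < 2 |f t| for large n if f t != 0 while the new values are all 0 if
    f t = 0, and now |f - g n|^p <= 3^p |f|^p, so that dominated convergence
    applies. *)
Lemma simple_fun_dense f (e : R) : Bochner_fun_set mu p f -> 0 < e ->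
  exists2 g, simple_fun g & (N (f - g)%R < e%:E)%E.
Proof.
move=> [mf Nf] e0; have [s ss sf] := mf.
pose K n := [set t | `|s n t| <= 2 * `|f t|].
have mK n : measurable (K n).
  rewrite -[K n]setTI; apply: measurable_fun_le => //.
    exact/strongly_measurable_norm/simple_fun_strongly_measurable.
  by apply: measurable_funM => //; exact: strongly_measurable_norm.
pose g n t := if t \in K n then s n t else 0.
have sg n : simple_fun (g n).
  have [fins ms] := ss n; split.
    have fin0 : finite_set (range (s n) `|` [set 0]) by rewrite finite_setU.
    apply: sub_finite_set fin0 => _ [t _ <-]; rewrite /g.
    by case: ifP => _; [left; exists t|right].
  move=> y; rewrite (_ : _ @^-1` _ =
      (s n @^-1` [set y] `&` K n) `|` (step setT 0 @^-1` [set y] `&` ~` K n)).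
    apply: measurableU; apply: measurableI => //; last exact: measurableC.
    by apply: (step_simple _ _).2.
  apply/seteqP; split=> t /=; rewrite /g /step scaler0.
    by case: ifPn => [/set_mem Kt|/negP Kt] ?; [left|right]; split=> //;
      move/mem_set.
  move=> [[sy Kt]|[y0 Kt]]; first by rewrite mem_set.
  by case: ifPn => // /set_mem.
have mg n := simple_fun_strongly_measurable (sg n).
have pow_m (h : T -> X) : strongly_measurable h ->
    measurable_fun setT (fun t => (`|h t| `^ p)%:E).
  move=> /strongly_measurable_norm mh; apply/measurable_EFinP.
  exact: (measurableT_comp (measurable_powR p)).
have dist n t : `|f t - g n t| <= 3 * `|f t|.
  rewrite /g; case: ifPn => [/set_mem Kt|_].
    apply: le_trans (ler_normB _ _) _; move: Kt; rewrite /K/=; lra.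
  by rewrite subr0 ler_peMl//; lra.
have cvgg t : `|f t - g n t| @[n --> \oo] --> 0.
  rewrite -(normr0 X); apply: cvg_norm; rewrite -(subrr (f t)).
  apply: cvgB; first exact: cvg_cst.
  have [ft0|ft0] := eqVneq (f t) 0.
    rewrite (_ : (fun n => g n t) = cst (f t)); first exact: cvg_cst.
    apply/funext => n /=; rewrite /g /K ft0; case: ifPn => // /set_mem/=.
    by rewrite ft0 normr0 mulr0 normr_le0 => /eqP.
  have ft20 : `|f t| < 2 * `|f t| by rewrite ltr_pMl ?normr_gt0//; lra.
  have near_s : \forall n \near \oo, s n t = g n t.
    apply: filterS (cvgr_norm_lt _ (sf t) _ ft20) => n snt.
    by rewrite /g mem_set//=; exact: ltW.
  exact: cvg_trans (near_eq_cvg near_s) (sf t).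
have idom : mu.-integrable setT (fun t => ((3 `^ p)%:E * (`|f t| `^ p)%:E)%E).
  apply: integrableZl => //; apply/integrableP; split; first exact: pow_m.
  move: Nf; rewrite Bochner_normE => /lty_poweRy.
  rewrite invr_eq0 lt0r_neq0// => /(_ isT); apply: le_lt_trans.
  rewrite le_eqVlt; apply/orP; left; apply/eqP/eq_integral => t _.
  by rewrite gee0_abs// lee_fin powR_ge0.
have lim0 t : (`|(f - g n) t| `^ p)%:E @[n --> \oo] --> 0%E.
  apply: cvg_EFin; first by apply: nearW => n; rewrite fin_numE.
  exact: powR_cvg0_seq (fun n => normr_ge0 _) (cvgg t).
have bound t n : (`| (`|(f - g n) t| `^ p)%:E | <=
    (3 `^ p)%:E * (`|f t| `^ p)%:E)%E.
  rewrite gee0_abs ?lee_fin ?powR_ge0// -powRM//.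
  by rewrite ge0_ler_powR ?nnegrE ?mulr_ge0 ?(ltW p_gt0)//; exact: dist.
have [_ _] := @dominated_convergence _ _ _ mu setT measurableT
  (fun n t => (`|(f - g n) t| `^ p)%:E) (cst 0%E) _
  (fun n => pow_m _ (strongly_measurableB mf (mg n))) (measurable_cst _)
  (aeW mu (fun t _ => lim0 t)) idom (aeW mu (fun t n _ => bound t n)).
rewrite integral0 => /(_ _ (nbhs_open_ereal_lt (f := fun=> e `^ p) _)).
rewrite powR_gt0// => /(_ isT)[n _ /(_ n (leqnn n)) small].
by exists (g n) => //; exact: Bochner_norm_lt.
Qed.



(** * Separability of Bochner spaces *)

(** Membership in the closure of C, stated for functions rather than for their
    classes so that step functions and sums can be handled pointwise. *)
Definition approximable (C : set (T -> X)) f := strongly_measurable f /\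
  forall e : R, 0 < e -> exists2 g, C g & (N (f - g)%R < e%:E)%E.

Section Approximable.
Variable C : set (T -> X).
Hypothesis C_meas : forall g, C g -> strongly_measurable g.
Hypotheses (C0 : C 0) (CD : forall f g, C f -> C g -> C (f + g)).

Lemma approximable_limit f : strongly_measurable f ->
  (forall e : R, 0 < e ->
    exists2 g, approximable C g & (N (f - g)%R < e%:E)%E) ->
  approximable C f.
Proof.
move=> mf fC; split=> // e e0.
have e20 : 0 < e / 2 by rewrite divr_gt0.
have [g [mg gC] fg] := fC _ e20; have [h Ch gh] := gC _ e20.
exists h => //; rewrite -(subrKA g).
apply: le_lt_trans (Bochner_normD mu p1 _ _) _.
- exact: strongly_measurableB.
- exact/strongly_measurableB/C_meas.
by rewrite (splitr e) EFinD lteD.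
Qed.

Lemma approximableD f g : approximable C f -> approximable C g ->
  approximable C (f + g).
Proof.
move=> [mf fC] [mg gC]; split=> [|e e0]; first exact: strongly_measurableD.
have e20 : 0 < e / 2 by rewrite divr_gt0.
have [f' Cf' ff'] := fC _ e20; have [g' Cg' gg'] := gC _ e20.
exists (f' + g'); first exact: CD.
rewrite opprD addrACA; apply: le_lt_trans (Bochner_normD mu p1 _ _) _.
- exact/strongly_measurableB/C_meas.
- exact/strongly_measurableB/C_meas.
by rewrite (splitr e) EFinD lteD.
Qed.

Lemma approximable_self g : C g -> approximable C g.
Proof.
move=> Cg; split=> [|e e0]; first exact: C_meas.
exists g => //; rewrite subrr; apply: Bochner_norm_lt => //.
rewrite integral0_eq ?lte_fin ?powR_gt0// => t _.
by rewrite normr0 powR0// lt0r_neq0.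
Qed.

Lemma approximable_step_limit A x : measurable A ->
  (forall e : R, 0 < e -> exists B y, [/\ measurable B,
    approximable C (step B y) & (N (step A x - step B y)%R < e%:E)%E]) ->
  approximable C (step A x).
Proof.
move=> mA AB; apply: approximable_limit; first exact: step_strongly_measurable.
by move=> e /AB[B [y [_ Cy small]]]; exists (step B y).
Qed.

(** Proper differences are dealt with by
    step (A \ B) x = step A x + step B (- x), and increasing unions by
    continuity from above of the finite measure mu, applied to the differences
    of the union and its members. *)
Lemma lambda_system_approximable : (mu setT < +oo)%E ->
  (forall x, approximable C (step setT x)) ->
  lambda_system setT
    [set A | measurable A /\ forall x, approximable C (step A x)].
Proof.
move=> fmu CT; split => //.
- move=> A B BA [mA CA] [mB CB]; split=> [|x]; first exact: measurableD.
  rewrite (_ : step _ _ = step A x + step B (- x)); first exact: approximableD.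
  apply/funext => t; rewrite -[RHS]/(step A x t + step B (- x) t) !stepE.
  have [At|At] := boolP (t \in A); have [Bt|Bt] := boolP (t \in B).
  + rewrite subrr ifN//; apply/negP => /set_mem[_]; apply; exact/set_mem.
  + rewrite addr0 mem_set//; split; first exact/set_mem.
    by move=> /mem_set; apply/negP.
  + by case/negP: At; apply/mem_set/BA/set_mem.
  + rewrite addr0 ifN//; apply/negP => /set_mem[/mem_set].
    by rewrite (negPf At).
- move=> F ndF CF; have mF n := (CF n).1.
  have mU : measurable (\bigcup_n F n) by exact: bigcupT_measurable.
  split=> // x; apply: approximable_limit => [|e e0].
    exact: step_strongly_measurable.
  pose D n := (\bigcup_n F n) `\` F n.
  have mD n : measurable (D n) by exact: measurableD.
  have D_small : mu (D n) @[n --> \oo] --> 0%E.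
    rewrite -(measure0 mu) -(_ : \bigcap_n D n = set0); last first.
      apply/seteqP; split=> // t Dt; have [[n _ Fnt] _] := Dt 0%N I.
      by have [_] := Dt n I; apply.
    apply: nonincreasing_cvg_mu => //.
    + apply: le_lt_trans fmu; apply: le_measure; rewrite ?inE//; exact: subsetT.
    + exact: bigcapT_measurable.
    + move=> n m nm; apply/subsetPset => t [Ut Ft]; split=> //.
      by have /subsetPset sub := ndF _ _ nm; move/sub.
  have r0 : 0 < e / (`|x| + 1) by rewrite divr_gt0// ltr_wpDl.
  have [n _ /(_ n (leqnn n)) Dn] := D_small _ (nbhs_open_ereal_lt
    (f := fun=> (e / (`|x| + 1)) `^ p) (powR_gt0 _ r0)).
  exists (step (F n) x); first exact: (CF n).2.
  rewrite (_ : _ - _ = step (D n) x).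
    apply: le_lt_trans (Bochner_norm_step x (mD n) r0 Dn) _.
    by rewrite lte_fin mulrCA gtr_pMr// ltr_pdivrMr ?mul1r ?ltrDl// ltr_wpDl.
  apply/funext => t; rewrite -[LHS]/(step _ x t - step (F n) x t) !stepE.
  have [Ft|Ft] := boolP (t \in F n).
    rewrite mem_set; last by exists n => //; exact/set_mem.
    by rewrite subrr ifN//; apply/negP => /set_mem[_]; apply; exact/set_mem.
  rewrite subr0; have [Ut|Ut] := boolP (t \in \bigcup_n F n).
    rewrite mem_set//; split; first exact/set_mem.
    by move=> /mem_set; apply/negP.
  by rewrite ifN//; apply/negP => /set_mem[/mem_set]; rewrite (negPf Ut).
Qed.

Lemma approximable_simple f :
  (forall A x, measurable A -> approximable C (step A x)) ->
  simple_fun f -> approximable C f.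
Proof.
move=> CA [/finite_seqP[s rs] ms].
rewrite (_ : f = \sum_(y <- undup s) step (f @^-1` [set y]) y).
  elim/big_ind : _ => [||y _]; last exact: CA.
    exact: approximable_self.
  exact: approximableD.
apply/funext => t; rewrite fct_sumE.
have fts : f t \in undup s.
  by rewrite mem_undup; have : range f (f t); [exists t|rewrite rs].
rewrite (bigD1_seq (f t)) ?undup_uniq//= stepE mem_set// big1 ?addr0// => y yft.
by rewrite stepE ifN//; apply/negP => /set_mem/=; apply/eqP; rewrite eq_sym.
Qed.

Lemma approximable_Bochner_fun f :
  (forall A x, measurable A -> approximable C (step A x)) ->
  Bochner_fun_set mu p f -> approximable C f.
Proof.
move=> CA Lf; apply: approximable_limit; first exact: Lf.1.
move=> e e0; have [g sg fg] := simple_fun_dense Lf e0.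
by exists g => //; exact: approximable_simple.
Qed.

End Approximable.

Lemma separable_Bochner_approx (C : set (T -> X)) : countable C ->
  C `<=` Bochner_fun_set mu p ->
  (forall f, Bochner_fun_set mu p f -> approximable C f) ->
  separable (Bochner mu X p1).
Proof.
move=> /countable_injP[h hinj] CL Cdense.
pose F : set (Bochner_fun mu X p1) := [set f | C f].
have cF : countable F.
  apply/countable_injP; exists (fun f => h f) => f g /set_mem Cf /set_mem Cg.
  by move=> /hinj fg; apply/val_inj/fg; exact/mem_set.
exists (@Bochner_class _ _ _ mu X p p1 @` F).
  exact: sub_countable (card_image_le _ _) cF.
move=> O [u Ou] oO.
have /nbhs_ballP[e /= e0 ueO] : nbhs u O by exact: open_nbhs_nbhs.
elim/Bochner_ind: u ueO {Ou} => f fO.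
have Lf : Bochner_fun_set mu p f.
  by split; [exact: Bochner_fun_meas|exact: Bochner_fun_fin].
have [_ /(_ _ e0)[g Cg fg]] := Cdense f Lf.
pose g' : Bochner_fun mu X p1 := BochnerFun (mem_set (CL _ Cg)).
exists (Bochner_class g'); split; last by exists g'.
apply: fO; rewrite -ball_normE /ball_/=.
rewrite (_ : Bochner_class f - Bochner_class g' = Bochner_class (f - g'));
  last first.
  by apply: (canLR (addrK _)); rewrite -Bochner_classD subrK.
rewrite -[X in X < _]/(Lp_norm _) Lp_norm_class -lte_fin fineK//.
exact: Bochner_norm_fin.
Qed.

Lemma lt_powR_fin A : (mu A < +oo)%E ->
  exists2 c : R, 0 < c & (mu A < (c `^ p)%:E)%E.
Proof.
move=> fA; have Afin : mu A \is a fin_num by rewrite ge0_fin_numE.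
have A0 : 0 < fine (mu A) + 1 by rewrite ltr_wpDl// fine_ge0.
exists ((fine (mu A) + 1) `^ p^-1); first exact: powR_gt0.
rewrite -powRrM mulVf ?lt0r_neq0// powRr1 ?(ltW A0)//.
by rewrite EFinD fineK// lteDl// lte01.
Qed.

Lemma step_Bochner_fun A x : measurable A -> (mu A < +oo)%E ->
  Bochner_fun_set mu p (step A x).
Proof.
move=> mA /lt_powR_fin[c c0 Ac]; split; first exact: step_strongly_measurable.
exact: le_lt_trans (Bochner_norm_step x mA c0 Ac) (ltry _).
Qed.

(** The countable dense set consists of the finite sums of step A y with A in G
    and y in a countable dense subset D of X.  Vectors x outside D are reached
    because |step A x - step A y| is |x - y| times the p-th root of mu A, and
    measurable sets outside G through the pi-lambda theorem. *)
Lemma separable_Bochner (G : set (set T)) :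
  countable G -> setI_closed G -> G setT -> G `<=` measurable ->
  measurable `<=` <<s G >> -> (mu setT < +oo)%E -> separable X ->
  separable (Bochner mu X p1).
Proof.
move=> cG IG GT Gm mG fmu [D cD dD].
have fin A : measurable A -> (mu A < +oo)%E.
  move=> mA; apply: le_lt_trans fmu; apply: le_measure; rewrite ?inE//.
pose H := [set step A.1 A.2 | A in G `*` D].
have [y0 Dy0 _] := dense_dist (0 : X) dD ltr01.
have cH : countable H.
  exact: sub_countable (card_image_le _ _) (countableX cG cD).
have H0 : H !=set0 by exists (step setT y0), (setT, y0).
have [h hH] := countable_nonempty_range cH H0.
pose C := range (fun s : seq nat => \sum_(n <- s) h n).
have cC : countable C.
  exact: sub_countable (card_image_le _ _) (countableP _).
have CH A y : G A -> D y -> C (step A y).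
  move=> GA Dy; have : H (step A y) by exists (A, y).
  by rewrite -hH => -[n _ <-]; exists [:: n] => //; rewrite big_seq1.
have CL : C `<=` Bochner_fun_set mu p.
  move=> _ [s _ <-]; elim/big_ind : _ => [|f g Lf Lg|n _].
  - exact: Bochner_fun0.
  - by rewrite -[f]scale1r; exact: Bochner_fun_lin.
  - have : H (h n) by rewrite -hH; exists n.
    move=> [[A y] [/= /Gm mA _] <-].
    by apply: step_Bochner_fun => //; exact: fin.
have Cm g : C g -> strongly_measurable g by move=> /CL[].
have C0 : C 0 by exists [::] => //; rewrite big_nil.
have CD f g : C f -> C g -> C (f + g).
  by move=> [s _ <-] [s' _ <-]; exists (s ++ s') => //; rewrite big_cat.
have GC A x : G A -> approximable C (step A x).
  move=> GA; have mA := Gm _ GA; apply: approximable_step_limit => // e e0.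
  have [c c0 Ac] := lt_powR_fin (fin _ mA).
  have [y Dy xy] := dense_dist x dD (divr_gt0 e0 c0).
  exists A, y; split=> //; first by apply: approximable_self => //; exact: CH.
  rewrite (_ : _ - _ = step A (x - y)); last first.
    by apply/funext => t; rewrite /step scalerBr.
  apply: le_lt_trans (Bochner_norm_step _ mA c0 Ac) _.
  by rewrite lte_fin -ltr_pdivlMr.
have stepC A x : measurable A -> approximable C (step A x).
  have GL : G `<=`
      [set A | measurable A /\ forall x, approximable C (step A x)].
    by move=> B GB; split=> [|z]; [exact: Gm|exact: GC].
  have lam := lambda_system_approximable Cm CD fmu (fun z => GC _ z GT).
  move=> mA.
  have inT B : <<s G >> B -> B `<=` setT by move=> _; exact: subsetT.
  by have [_] := lambda_system_subset IG lam GL inT (mG _ mA).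
apply: separable_Bochner_approx cC CL _ => f.
exact: approximable_Bochner_fun.
Qed.

End BochnerDensity.

Section Lebesgue.
Context {R : realType}.

(** The whole line belongs to every lambda-system, so that its indicator has to
    be approximated from the outset; including it keeps the family closed under
    intersection. *)
Definition rational_rays : set (set R) :=
  [set A | A = setT \/ exists q : rat, A = `]ratr q, +oo[%classic].

Lemma countable_rational_rays : countable rational_rays.
Proof.
apply: (@sub_countable _ _ _ [set if q is Some q then `]ratr q, +oo[%classic
    else setT | q in [set: option rat]]).
  apply: subset_card_le => A [->|[q ->]]; [by exists None|by exists (Some q)].
exact: sub_countable (card_image_le _ _) (countableP _).
Qed.

Lemma rational_rays_setI : setI_closed rational_rays.
Proof.
move=> A B [->|[q ->]] [->|[r ->]]; rewrite ?setTI ?setIT.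
- by left.
- by right; exists r.
- by right; exists q.
- right; have [qr|/ltW rq] := leP q r; [exists r|exists q].
    rewrite setIidr// => t /=; rewrite !in_itv/= !andbT.
    by apply: le_lt_trans; rewrite ler_rat.
  rewrite setIidl// => t /=; rewrite !in_itv/= !andbT.
  by apply: le_lt_trans; rewrite ler_rat.
Qed.

Lemma measurable_rational_rays :
  @measurable _ (measurableTypeR R) `<=` <<s rational_rays >>.
Proof.
rewrite (_ : @measurable _ (measurableTypeR R) =
  (@RGenOInfty.G R).-sigma.-measurable); last first.
  exact: RGenOInfty.measurableE.
apply: smallest_sub; first exact: smallest_sigma_algebra.
move=> _ [x ->].
rewrite (_ : `]x, +oo[%classic = \bigcup_(q in [set q : rat | x < ratr q])
    `]ratr q, +oo[%classic).
  rewrite bigcup_mkcond.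
  apply: (@bigcupT_measurable_rat _ (g_sigma_algebraType rational_rays)) => q.
  case: ifP => _; last exact: measurable0.
  by apply: sub_sigma_algebra; right; exists q.
apply/seteqP; split=> t /=.
  rewrite in_itv/= andbT => /rat_in_itvoo[q]; rewrite in_itv/= => /andP[xq qt].
  by exists q => //=; rewrite in_itv/= qt.
by move=> [q /= xq]; rewrite !in_itv/= !andbT; exact: lt_trans.
Qed.

Lemma separable_Bochner_lebesgue01 (X : normedModType R) (p : R)
    (p1 : 1 <= p) :
  separable X -> separable (Bochner (lebesgue01 R) X p1).
Proof.
move=> sX.
apply: (@separable_Bochner _ (measurableTypeR R) R (lebesgue01 R) X p p1
  rational_rays) => //.
- exact: countable_rational_rays.
- exact: rational_rays_setI.
- by left.
- by move=> _ [->|[q ->]]; [exact: measurableT|exact: measurable_itv].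
- exact: measurable_rational_rays.
- rewrite /lebesgue01/= /mrestr setTI lebesgue_measure_itv/=.
  by case: ifP => _; rewrite ?ltry// -EFinB ltry.
Qed.

End Lebesgue.

Theorem corollary1p4 (R : realType) (p : R) (hp : 1 < p)
    (X : completeNormedModType R) (lambda : R)
    (Xsep : separable X) (Xuc : uniformly_convex X)
    (Xpi : pi_property X lambda) (hlambda : 1 <= lambda)
    (E : completeNormedModType R) (Esep : separable (bounded_op E R)) :
  (forall (d : measure_display) (T : measurableType d)
      (mu : {measure set T -> \bar R}),
    let Y := Bochner mu X (ltW hp) in
    separable Y -> (lambda%:E < Lambda Y)%E ->
    forall Z : set (bounded_op E Y), closed_subspace Z ->
      (forall f : bounded_op E Y, finite_rank f -> Z f) -> UBCP Z)
  /\
  (let Y := Bochner (lebesgue01 R) X (ltW hp) in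
    (lambda%:E < Lambda Y)%E ->
    forall Z : set (bounded_op E Y), closed_subspace Z ->
      (forall f : bounded_op E Y, finite_rank f -> Z f) -> UBCP Z).
Proof.
have main (Y : normedModType R) : separable Y -> (lambda%:E < Lambda Y)%E ->
    forall Z : set (bounded_op E Y), closed_subspace Z ->
      (forall f : bounded_op E Y, finite_rank f -> Z f) -> UBCP Z.
  move=> Ysep /(midpoint_gap_Lambda hlambda)[eta [D [eta01 D01 gapY]]] Z.
  exact: UBCP_rank_one eta01 D01 gapY Esep Ysep.
split=> [d T mu Y|Y]; first exact: main.
exact/main/separable_Bochner_lebesgue01.
Qed.
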